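(* Consider the normal means model $y=\beta+\varepsilon$, $\varepsilon\sim N(0,I_n)$, $\beta\in\mathcal B(n,s_n)$, with $\limsup_n s_n/n=\zeta\in[0,1)$. There exist an absolute constant $C>0$ and a sequence $\delta_n$ with $\delta_n\to0$ as $n,s_n\to\infty$ such that every estimator $\widehat\beta$ satisfies $$\sup_{\beta\in\mathcal B(n,s_n)}P_\beta(\mathrm{FP}(\widehat\beta)>0)\ \ge\ 1-\delta_n-\frac{\sup_{\beta\in\mathcal B(n,s_n)}E_\beta\|\widehat\beta-\beta\|^2}{C\,s_n\log n}.$$
   Context: $1\le s_n\le n$ are integers. $\mathcal B(n,s_n)=\{\beta\in\mathbb R^n:\|\beta\|_0\le s_n\}$, where $\|\beta\|_0$ is the number of nonzero entries. An estimator is any (measurable) function $\widehat\beta=\widehat\beta(y)\in\mathbb R^n$; it is allowed to depend on $s_n$. $P_\beta,E_\beta$ are probability and expectation for $y\sim N(\beta,I_n)$. $\mathrm{FP}(\widehat\beta)=|\{j:\widehat\beta_j\ne0,\ \beta_j=0\}|$. *)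

(* Defs.v *)
From HB Require Import structures.
From mathcomp Require Import all_boot all_order all_algebra.
From mathcomp Require Import all_classical all_reals all_analysis.

Set Implicit Arguments.
Unset Strict Implicit.
Unset Printing Implicit Defensive.

Import Order.TTheory GRing.Theory Num.Theory.
Import numFieldNormedType.Exports.
Local Open Scope classical_set_scope.
Local Open Scope ring_scope.

Section cons_pair.
Context {R : realType} (n : nat).

(* The library carries [normal_prob] on [measurableTypeR R], whose
   sigma-algebra is that of [R] but whose display differs. *)
Definition cons_pair (p : measurableTypeR R * n.-tuple R) : n.+1.-tuple R :=
  [tuple of (p.1 : R) :: p.2].

Lemma measurable_cons_pair :
  measurable_fun [set: measurableTypeR R * n.-tuple R] cons_pair.
Proof.
apply: (@measurable_cons _ _ _ R (fun p => p.1 : R) n snd) => //.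
exact: (@measurable_fst _ _ (measurableTypeR R) (n.-tuple R)).
Qed.

HB.instance Definition _ :=
  isMeasurableFun.Build _ _ _ _ cons_pair measurable_cons_pair.

End cons_pair.

(* N(b, I_n) on R^n, as the product of the N(b_i, 1); see [mvnormalE]. *)
Fixpoint mvnormal {R : realType} (n : nat) :
    n.-tuple R -> probability (n.-tuple R) R :=
  match n with
  | 0 => fun b => \d_ b
  | n'.+1 => fun b =>
      distribution
        (normal_prob (thead b) 1 \x
          mvnormal ([tuple of behead b] : n'.-tuple R))%E
        (@cons_pair R n')
  end.

Lemma mvnormalE {R : realType} (n : nat) (b : n.-tuple R)
    (A : 'I_n -> set R) : (forall i, measurable (A i)) ->
  mvnormal b [set y | forall i, A i (tnth y i)] =
    (\prod_(i < n) normal_prob (tnth b i) 1 (A i))%E.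
Proof.
elim: n b A => [|n IH] b A mA.
  rewrite big_ord0 /= diracE mem_set// => -[]//.
rewrite big_ord_recl /= /distribution /= /pushforward.
have -> : @cons_pair R n @^-1` [set y | forall i, A i (tnth y i)] =
    A ord0 `*` [set y | forall i, A (lift ord0 i) (tnth y i)].
  apply/seteqP; split => [[x y] /= H|[x y] /= [Hx Hy] i].
    split; first by have := H ord0; rewrite tnth0.
    by move=> i; have := H (lift ord0 i); rewrite /cons_pair/= tnthS.
  by have [j ->|->] := unliftP ord0 i; rewrite /cons_pair/= ?tnthS ?tnth0.
rewrite product_measure1E//=; last first.
  rewrite (_ : [set _ | _] = \big[setI/setT]_(i < n)
    ((@tnth n R)^~ i @^-1` A (lift ord0 i))); last first.
    apply/seteqP; split => y /=; rewrite -bigcap_seq/=.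
      by move=> H i _; exact: H.
    by move=> H i; apply: H => /=; rewrite mem_index_enum.
  apply: bigsetI_measurable => i _; rewrite -[X in measurable X]setTI.
  exact: measurable_tnth.
  exact: mA.
congr (_ * _)%E; transitivity (\prod_(i < n)
    normal_prob (tnth [tuple of behead b] i) 1 (A (lift ord0 i)))%E.
  exact: (IH _ (fun i => A (lift ord0 i))).
apply: eq_bigr => i _.
by congr (normal_prob _ 1 _); rewrite [in RHS](tuple_eta b) tnthS.
Qed.

Section sparse_normal_means.
Context {R : realType} (n : nat).
Implicit Types b e : n.-tuple R.

Definition l0norm b : nat := #|[pred j : 'I_n | tnth b j != 0]|.

Definition sparse_ball (s : nat) : set (n.-tuple R) :=
  [set b | (l0norm b <= s)%N].

Definition sqdist e b : R := \sum_(j < n) (tnth e j - tnth b j) ^+ 2.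

(* [e] is the value of the estimator, [b] the true parameter. *)
Definition false_positives e b : nat :=
  #|[pred j : 'I_n | (tnth e j != 0) && (tnth b j == 0)]|.

Definition FP_prob (bhat : n.-tuple R -> n.-tuple R) b : \bar R :=
  mvnormal b [set y | (0 < false_positives (bhat y) b)%N].

Definition sq_risk (bhat : n.-tuple R -> n.-tuple R) b : \bar R :=
  ('E_(mvnormal b)[fun y => sqdist (bhat y) b])%E.

End sparse_normal_means.

(* Main.v *)
Require Import Defs.
From HB Require Import structures.
From mathcomp Require Import all_boot all_order all_algebra.
From mathcomp Require Import all_classical all_reals all_analysis.
From mathcomp Require Import measurable_realfun ring lra zify.

Set Implicit Arguments.
Unset Strict Implicit.
Unset Printing Implicit Defensive.

Import Order.TTheory GRing.Theory Num.Theory.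
Import numFieldNormedType.Exports.
Local Open Scope classical_set_scope.
Local Open Scope ring_scope.

(* Fix a signal height t and a support size k.+1. Given a support S of size k
   and a uniformly random j outside S, the law of y under the support j |: S
   is indistinguishable from its law under S: the likelihood ratio of
   the mixture has variance (exp (t ^ 2) - 1) / (n - k), which vanishes for
   t ^ 2 = ln n / 2. Hence an estimator that selects j under j |: S also selects
   some coordinate outside S under S, which is a false positive. On the other
   hand, failing to select j in the support T costs t ^ 2, so the
   frequency of such failures, averaged over j in T, is at most the risk
   divided by k.+1 * t ^ 2. Double counting the pairs (T, j) with j in T as
   pairs (S, j) with j outside S combines both facts. Supports of size about
   s n / 2 already suffice, and they leave at least n / 2 positions for j. *)

(** * One-dimensional Gaussian change of measure *)

Section normal_shift.
Context {R : realType}.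
Local Notation mu := (@lebesgue_measure R).
Implicit Types (m t : R) (f : R -> \bar R).

(** Change of variables yields the Radon-Nikodym derivative, which agrees almost everywhere with the
    explicit density since both have the same integral over every measurable set. *)
Lemma ge0_integral_normal_prob m (sigma : R) f :
  measurable_fun [set: R] f -> (forall x, 0 <= f x)%E ->
  (\int[normal_prob m sigma]_x f x =
   \int[mu]_x (f x * (normal_pdf m sigma x)%:E))%E.
Proof.
move=> mf f0.
have dom := @normal_prob_dominates R m sigma.
rewrite -(Radon_Nikodym_SigmaFinite.change_of_variables dom)//.
apply: ae_eq_integral => //.
- apply: emeasurable_funM => //.
  exact: measurable_int (Radon_Nikodym_SigmaFinite.f_integrable dom).
- apply: emeasurable_funM => //; apply/measurable_EFinP.
  exact: measurable_normal_pdf.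
- apply: ae_eqe_mul2l; apply: integral_ae_eq => //=.
  + exact: Radon_Nikodym_SigmaFinite.f_integrable.
  + by apply/measurable_EFinP; exact: measurable_normal_pdf.
  + by move=> E _ mE; rewrite -Radon_Nikodym_SigmaFinite.f_integral.
Qed.

Lemma normal_pdf_shift m t x :
  normal_pdf (m + t) 1 x =
  expR (t * (x - m) - t ^+ 2 / 2) * normal_pdf m 1 x.
Proof.
rewrite !normal_pdfE ?oner_eq0// mulrCA /normal_fun -expRD.
by congr (_ * expR _); field.
Qed.

Lemma ge0_integral_normal_shift m t f :
  measurable_fun [set: R] f -> (forall x, 0 <= f x)%E ->
  (\int[normal_prob (m + t) 1]_x f x =
   \int[normal_prob m 1]_x
     (f x * (expR (t * (x - m) - t ^+ 2 / 2))%:E))%E.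
Proof.
move=> mf f0; rewrite ge0_integral_normal_prob//.
apply/esym; apply: etrans; first apply: ge0_integral_normal_prob.
- apply: emeasurable_funM => //; apply/measurable_EFinP.
  apply: measurableT_comp => //; apply: measurable_funB => //.
  by apply: measurable_funM => //; exact: measurable_funB.
- by move=> x; rewrite mule_ge0// lee_fin expR_ge0.
- by apply: eq_integral => x _; rewrite normal_pdf_shift EFinM muleA.
Qed.

End normal_shift.

(** * Shifting one coordinate of the Gaussian product measure *)

Section mvnormal_shift.
Context {R : realType}.

Lemma ge0_integral_mvnormalS n (b : n.+1.-tuple R)
    (f : n.+1.-tuple R -> \bar R) :
  measurable_fun setT f -> (forall y, 0 <= f y)%E ->
  (\int[mvnormal b]_y f y =
   \int[normal_prob (thead b) 1]_x \int[mvnormal [tuple of behead b]]_y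
      f (cons_pair (x, y)))%E.
Proof.
move=> mf f0; rewrite /= ge0_integral_distribution//.
rewrite fubini_tonelli1//; last by move=> x /=; exact: f0.
by apply: measurableT_comp => //; exact: measurable_cons_pair.
Qed.

(** The likelihood ratio of N(b + t e_k, I_n) to N(b, I_n). *)
Definition shift_weight n (b : n.-tuple R) (k : 'I_n) (t : R)
    (y : n.-tuple R) : R :=
  expR (t * (tnth y k - tnth b k) - t ^+ 2 / 2).

Lemma measurable_shift_weight n (b : n.-tuple R) k t :
  measurable_fun setT (shift_weight b k t).
Proof.
apply: measurableT_comp => //; apply: measurable_funB => //.
apply: measurable_funM => //; apply: measurable_funB => //.
exact: measurable_tnth.
Qed.

(** Induction along the head/tail product. If [k] lies in the tail, the heads agree and the
    induction hypothesis applies to the inner integral. If [k] is the head, the tails agree and the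
    one-dimensional shift applies to the outer integral, the weight being constant for the inner
    one. *)
Lemma ge0_integral_mvnormal_shift n (b b' : n.-tuple R) (k : 'I_n) (t : R)
    (f : n.-tuple R -> \bar R) :
  tnth b' k = tnth b k + t -> (forall i, i != k -> tnth b' i = tnth b i) ->
  measurable_fun setT f -> (forall y, 0 <= f y)%E ->
  (\int[mvnormal b']_y f y =
   \int[mvnormal b]_y (f y * (shift_weight b k t y)%:E))%E.
Proof.
elim: n b b' k f => [|n IH] b b' k f; first by case: k.
move=> bk bi mf f0.
have mfw : measurable_fun setT (fun y => f y * (shift_weight b k t y)%:E)%E.
  apply: emeasurable_funM => //; apply/measurable_EFinP.
  exact: measurable_shift_weight.
have fw0 y : (0 <= f y * (shift_weight b k t y)%:E)%E.
  by rewrite mule_ge0// lee_fin expR_ge0.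
have mcons x : measurable_fun setT (fun y => @cons_pair R n (x, y)).
  apply: measurableT_comp; first exact: measurable_cons_pair.
  exact: measurable_pair1.
have tnth_behead (c : n.+1.-tuple R) i :
    tnth c (lift ord0 i) = tnth [tuple of behead c] i.
  by rewrite {1}(tuple_eta c) tnthS.
apply: etrans (ge0_integral_mvnormalS b' mf f0) _.
apply/esym; apply: etrans (ge0_integral_mvnormalS b mfw fw0) _; apply/esym.
have [j kj|k0] := unliftP ord0 k.
- subst k.
  have -> : thead b' = thead b by rewrite /thead bi.
  apply: eq_integral => x _.
  have bj : tnth [tuple of behead b'] j = tnth [tuple of behead b] j + t.
    by rewrite -!tnth_behead.
  have bij i : i != j ->
      tnth [tuple of behead b'] i = tnth [tuple of behead b] i.
    by move=> ij; rewrite -!tnth_behead bi.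
  have mfx : measurable_fun setT (fun y => f (@cons_pair R n (x, y))).
    exact: measurableT_comp.
  have fx0 y : (0 <= f (@cons_pair R n (x, y)))%E by exact: f0.
  apply: etrans (IH _ _ _ _ bj bij mfx fx0) _.
  apply: eq_integral => y _; congr (_ * _)%E; congr EFin.
  by rewrite /shift_weight (tnth_behead b) /cons_pair/= tnthS.
- subst k.
  have -> : thead b' = thead b + t by rewrite /thead bk.
  have -> : [tuple of behead b'] = [tuple of behead b].
    by apply: eq_from_tnth => i; rewrite -!tnth_behead bi.
  rewrite ge0_integral_normal_shift.
  + apply: eq_integral => x _; rewrite -ge0_integralZr//.
    exact: measurableT_comp.
  + apply: (@measurable_fun_fubini_tonelli_F _ _ _ _ _
      (mvnormal [tuple of behead b]) (f \o @cons_pair R n)); last first.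
      by move=> ?; exact: f0.
    by apply: measurableT_comp => //; exact: measurable_cons_pair.
  + by move=> x; apply: integral_ge0.
Qed.

End mvnormal_shift.

(** * Sums over a finite set under the integral *)

Lemma measurable_sum_in d (T : measurableType d) (R : realType) (I : finType)
    (J : {set I}) (f : I -> T -> R) :
  (forall i, measurable_fun setT (f i)) ->
  measurable_fun setT (fun x => \sum_(i in J) f i x).
Proof.
move=> mf; under eq_fun do rewrite -big_enum/=.
exact: measurable_sum.
Qed.

Lemma ge0_integral_sum_in d (T : measurableType d) (R : realType)
    (mu : {measure set T -> \bar R}) (I : finType) (J : {set I})
    (f : I -> T -> R) :
  (forall i, measurable_fun setT (f i)) -> (forall i x, 0 <= f i x) ->
  (\int[mu]_x (\sum_(i in J) f i x)%:E = \sum_(i in J) \int[mu]_x (f i x)%:E)%E.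
Proof.
move=> mf f0; rewrite -big_enum/= -ge0_integral_sum//.
- by apply: eq_integral => x _; rewrite -sumEFin big_enum.
- by move=> i; exact/measurable_EFinP.
- by move=> i x _; rewrite lee_fin.
Qed.

(** * Moments of the likelihood ratios *)

Section add_coord.
Context {R : realType} (n : nat) (b : n.-tuple R) (t : R).

Definition add_coord (j : 'I_n) : n.-tuple R :=
  [tuple tnth b i + t *+ (i == j) | i < n].

Local Notation w := (fun j => shift_weight b j t).

Lemma ge0_integral_add_coord j (f : n.-tuple R -> R) :
  measurable_fun setT f -> (forall y, 0 <= f y) ->
  (\int[mvnormal (add_coord j)]_y (f y)%:E =
   \int[mvnormal b]_y (f y * w j y)%:E)%E.
Proof.
move=> mf f0; rewrite (@ge0_integral_mvnormal_shift _ _ b _ j t)//.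
- by rewrite tnth_mktuple eqxx.
- by move=> i /negbTE ij; rewrite tnth_mktuple ij addr0.
- exact/measurable_EFinP.
Qed.

End add_coord.

Section mean_shift_weight.
Context {R : realType} (n : nat) (b : n.-tuple R) (t : R).
Local Notation w := (fun j => shift_weight b j t).

Lemma integral_shift_weight j : (\int[mvnormal b]_y (w j y)%:E = 1)%E.
Proof.
transitivity (\int[mvnormal (add_coord b t j)]_y (cst 1 y)%:E)%E.
  rewrite ge0_integral_add_coord//.
  by apply: eq_integral => y _; rewrite mul1r.
rewrite (@integral_cst _ _ _ _ _ measurableT 1%E) mul1e.
exact: probability_setT.
Qed.

End mean_shift_weight.

Section mixture_bound.
Context {R : realType} (n : nat) (b : n.-tuple R) (t : R).
Local Notation w := (fun j => shift_weight b j t).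

(** One weight is absorbed as a change of measure. Under the law shifted at [j], the other weight is
    again a likelihood ratio of mass 1, up to a factor exp (t ^ 2) from recentring when [k] is
    [j]. *)
Lemma integral_shift_weightM j k :
  (\int[mvnormal b]_y (w j y * w k y)%:E =
   (if j == k then expR (t ^+ 2) else 1)%:E)%E.
Proof.
under eq_integral do rewrite mulrC.
rewrite -ge0_integral_add_coord//; last 2 first.
- exact: measurable_shift_weight.
- by move=> y; exact: expR_ge0.
have wE y : w k y = (if j == k then expR (t ^+ 2) else 1) *
    shift_weight (add_coord b t j) k t y.
  rewrite /shift_weight tnth_mktuple (eq_sym k); case: eqP => _.
    by rewrite /= mulr1n -expRD; congr expR; field.
  by rewrite mul1r mulr0n addr0.
under eq_integral do rewrite wE EFinM.
rewrite ge0_integralZl//.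
- by rewrite integral_shift_weight mule1.
- by apply/measurable_EFinP; exact: measurable_shift_weight.
- by move=> y _; rewrite lee_fin expR_ge0.
- by rewrite lee_fin; case: ifP => // _; exact: expR_ge0.
Qed.

Lemma mvnormal_add_coord j (A : set (n.-tuple R)) : measurable A ->
  (mvnormal (add_coord b t j) A = \int[mvnormal b]_y (\1_A y * w j y)%:E)%E.
Proof.
move=> mA.
rewrite -[LHS](_ : \int[mvnormal (add_coord b t j)]_y (\1_A y)%:E = _)%E.
  by rewrite ge0_integral_add_coord.
by rewrite integral_indic// setIT.
Qed.

(** Divided by #|J|, the left side is the integral of 1_A W, with W the average of the weights over
    [J]. W has mean 1 and variance (exp (t ^ 2) - 1) / #|J|, and 1_A (W - 1) <= eps + (W - 1) ^ 2 /
    (4 eps) pointwise. *)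
Lemma sum_mvnormal_add_coord_le (J : {set 'I_n}) (A : set (n.-tuple R))
    (eps : R) :
  (0 < #|J|)%N -> 0 < eps -> measurable A ->
  (\sum_(j in J) mvnormal (add_coord b t j) A <=
   #|J|%:R%:E * (mvnormal b A +
     (eps + (expR (t ^+ 2) - 1) / (4 * eps * #|J|%:R))%:E))%E.
Proof.
move=> J0 eps0 mA; set N : R := #|J|%:R; set e := expR _.
have N0 : 0 < N by rewrite ltr0n.
pose q j := fine (mvnormal (add_coord b t j) A).
have qE j : (mvnormal (add_coord b t j) A = (q j)%:E)%E.
  by rewrite fineK ?fin_num_measure.
pose p := fine (mvnormal b A).
have pE : (mvnormal b A = p%:E)%E by rewrite fineK ?fin_num_measure.
under eq_bigr do rewrite qE.
rewrite pE sumEFin -EFinD -EFinM lee_fin.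
have mw j : measurable_fun setT (w j) by exact: measurable_shift_weight.
have w0 j y : 0 <= w j y by exact: expR_ge0.
pose f1 y := \sum_(j in J) (\1_A y * w j y).
pose f2 y := \sum_(j in J) w j y.
pose f3 y := \sum_(j in J) \sum_(k in J) w j y * w k y.
have mf1 : measurable_fun setT f1.
  by apply: measurable_sum_in => j; apply: measurable_funM.
have mf2 : measurable_fun setT f2 by exact: measurable_sum_in.
have mf3 : measurable_fun setT f3.
  apply: measurable_sum_in => j; apply: measurable_sum_in => k.
  exact: measurable_funM.
have f10 y : 0 <= f1 y by apply: sumr_ge0 => j _; exact: mulr_ge0.
have f20 y : 0 <= f2 y by apply: sumr_ge0 => j _.
have f30 y : 0 <= f3 y.
  by apply: sumr_ge0 => j _; apply: sumr_ge0 => k _; exact: mulr_ge0.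
have If1 : (\int[mvnormal b]_y (f1 y)%:E = (\sum_(j in J) q j)%:E)%E.
  rewrite ge0_integral_sum_in; last 2 first.
  - by move=> j; exact: measurable_funM.
  - by move=> j y; exact: mulr_ge0.
  by rewrite -sumEFin; apply: eq_bigr => j _; rewrite -mvnormal_add_coord.
have If2 : (\int[mvnormal b]_y (f2 y)%:E = N%:E)%E.
  rewrite ge0_integral_sum_in//.
  under eq_bigr do rewrite integral_shift_weight.
  by rewrite sumEFin sumr_const.
(* Second moment of [f2]: all N ^ 2 pairs contribute 1, and the N diagonal ones an excess of e -
   1. *)
have If3 : (\int[mvnormal b]_y (f3 y)%:E = (N ^+ 2 + N * (e - 1))%:E)%E.
  rewrite ge0_integral_sum_in; last 2 first.
  - by move=> j; apply: measurable_sum_in => k; exact: measurable_funM.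
  - by move=> j y; apply: sumr_ge0 => k _; exact: mulr_ge0.
  transitivity (\sum_(j in J) (N + (e - 1))%:E)%E; last first.
    by rewrite sumEFin sumr_const -mulr_natl -/N expr2; congr EFin; ring.
  apply: eq_bigr => j jJ; rewrite ge0_integral_sum_in; last 2 first.
  - by move=> k; exact: measurable_funM.
  - by move=> k y; exact: mulr_ge0.
  under eq_bigr do rewrite integral_shift_weightM.
  rewrite sumEFin; congr EFin.
  transitivity (\sum_(k in J) (1 + (if k == j then e - 1 else 0))).
    by apply: eq_bigr => k _; rewrite (eq_sym k); case: eqP;
      rewrite ?addr0// subrKC.
  rewrite big_split/= sumr_const; congr (_ + _).
  by rewrite (bigD1 j)//= eqxx big1 ?addr0// => k /andP[_ /negbTE ->].
(* Coefficients of the pointwise inequality after expanding (f2 / N - 1) ^ 2 / (4 eps) and moving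
   each negative term to the other side. *)
pose c1 : R := N^-1.
pose c2 := (2 * eps * N)^-1.
pose c3 := (4 * eps * N ^+ 2)^-1.
pose c4 := eps + (4 * eps)^-1.
have c10 : 0 <= c1 by rewrite invr_ge0 ltW.
have c20 : 0 <= c2 by rewrite invr_ge0 !mulr_ge0// ltW.
have c30 : 0 <= c3 by rewrite invr_ge0 !mulr_ge0 ?exprn_ge0// ltW.
have c40 : 0 <= c4 by rewrite addr_ge0 ?invr_ge0 ?mulr_ge0// ltW.
have If0 : (\int[mvnormal b]_y (\1_A y)%:E = p%:E)%E.
  by rewrite integral_indic// setIT; exact: pE.
have Ic4 : (\int[mvnormal b]_y c4%:E = c4%:E)%E.
  rewrite (@integral_cst _ _ _ _ _ measurableT c4%:E).
  rewrite [X in (c4%:E * X)%E](_ : _ = 1%E) ?mule1//; exact: probability_setT.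
(* AM-GM on 1_A (W - 1), with W = f2 / N, kept additive with nonnegative
   terms so that no integrability has to be checked. *)
have mono : (\int[mvnormal b]_y (c1%:E * (f1 y)%:E + c2%:E * (f2 y)%:E) <=
    \int[mvnormal b]_y ((\1_A y)%:E + (c4%:E + c3%:E * (f3 y)%:E)))%E.
  apply: ge0_le_integral => //.
  - by move=> y _; rewrite adde_ge0// mule_ge0// lee_fin.
  - apply: emeasurable_funD; apply: emeasurable_funM => //;
      exact/measurable_EFinP.
  - apply: emeasurable_funD; first by apply/measurable_EFinP.
    apply: emeasurable_funD => //; apply: emeasurable_funM => //.
    exact/measurable_EFinP.
  - move=> y _; rewrite -!EFinM -!EFinD lee_fin.
    have -> : f3 y = f2 y ^+ 2.
      rewrite /f3 expr2 {1}/f2 big_distrl/=; apply: eq_bigr => j _.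
      by rewrite big_distrr.
    have -> : f1 y = \1_A y * f2 y by rewrite /f1 -big_distrr.
    set W := f2 y; set a : R := \1_A y.
    have a01 : a = 0 \/ a = 1.
      by rewrite /a indicE; case: (_ \in _); [right|left].
    rewrite -subr_ge0.
    have -> : a + (c4 + c3 * W ^+ 2) - (c1 * (a * W) + c2 * W) =
        a * (1 - W / N + eps) + (1 - a) * eps + (W / N - 1) ^+ 2 / (4 * eps).
      by rewrite /c1 /c2 /c3 /c4; field; rewrite !gt_eqF.
    case: a01 => ->.
      rewrite mul0r add0r subr0 mul1r addr_ge0 ?(ltW eps0)//.
      by rewrite divr_ge0 ?sqr_ge0// mulr_ge0// ltW.
    rewrite subrr mul0r addr0 mul1r.
    have -> : 1 - W / N + eps + (W / N - 1) ^+ 2 / (4 * eps) =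
      (W / N - 1 - 2 * eps) ^+ 2 / (4 * eps).
      by field; rewrite !gt_eqF.
    by rewrite mulr_ge0 ?sqr_ge0// invr_ge0 mulr_ge0// ltW.
move: mono.
rewrite ge0_integralD//; last 4 first.
- by move=> y _; rewrite mule_ge0// lee_fin.
- by apply: emeasurable_funM => //; exact/measurable_EFinP.
- by move=> y _; rewrite mule_ge0// lee_fin.
- by apply: emeasurable_funM => //; exact/measurable_EFinP.
rewrite ge0_integralZl//; last 2 first.
- exact/measurable_EFinP.
- by move=> y _; rewrite lee_fin.
rewrite ge0_integralZl//; last 2 first.
- exact/measurable_EFinP.
- by move=> y _; rewrite lee_fin.
rewrite ge0_integralD//; last 3 first.
- exact/measurable_EFinP.
- by move=> y _; apply: adde_ge0;
    [rewrite lee_fin | rewrite mule_ge0// lee_fin].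
- apply: emeasurable_funD => //; apply: emeasurable_funM => //.
  exact/measurable_EFinP.
rewrite ge0_integralD//; last 2 first.
- by move=> y _; rewrite mule_ge0// lee_fin.
- by apply: emeasurable_funM => //; exact/measurable_EFinP.
rewrite ge0_integralZl//; last 2 first.
- exact/measurable_EFinP.
- by move=> y _; rewrite lee_fin.
rewrite If0 If1 If2 If3 Ic4 -!EFinM -!EFinD lee_fin => mono.
(* All integrals are now real numbers, so the cross term [c2 * N] can be subtracted back. *)
have {}mono : \sum_(j in J) q j / N <=
    p + (c4 + c3 * (N ^+ 2 + N * (e - 1))) - c2 * N.
  by rewrite lerBrDr -big_distrl/= mulrC.
apply: (@le_trans _ _ (N * (\sum_(j in J) q j / N))).
  by rewrite -big_distrl/= mulrC divfK// gt_eqF.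
rewrite ler_pM2l//; apply: le_trans mono _.
rewrite le_eqVlt; apply/orP; left; apply/eqP.
by rewrite /c2 /c3 /c4; field; rewrite !gt_eqF.
Qed.

End mixture_bound.

(** For fixed [j], adding and removing [j] are inverse bijections between the sets of size [k]
    avoiding [j] and those of size [k.+1] containing it. *)
Lemma sum_subsetsS (V : nmodType) (I : finType) (k : nat)
    (F : {set I} -> I -> V) :
  \sum_(T : {set I} | #|T| == k.+1) \sum_(j in T) F T j =
  \sum_(S : {set I} | #|S| == k) \sum_(j in ~: S) F (j |: S) j.
Proof.
rewrite (exchange_big_dep xpredT)//= [RHS](exchange_big_dep xpredT)//=.
apply: eq_bigr => j _.
rewrite (reindex_onto (fun S => j |: S) (fun T => T :\ j))/=; last first.
  by move=> T /andP[_ jT]; rewrite finset.setD1K.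
apply: eq_bigl => S; rewrite finset.setU11 andbT inE cardsU1.
(* If [j] is already in [S], removing it from [j |: S] does not give back [S], so the reindexing
   condition fails as required. *)
have [jS|jS] /= := boolP (j \in S); last first.
  by rewrite finset.setU1K// eqxx add1n eqSS andbT.
rewrite andbF; apply/negbTE; rewrite negb_and; apply/orP; right.
by apply/eqP => /setP/(_ j); rewrite !inE eqxx jS.
Qed.

(** * Sparse signals: false positives against risk *)

Section signal.
Context {R : realType} (n : nat) (t : R).
Implicit Types (S T : {set 'I_n}) (bhat : n.-tuple R -> n.-tuple R).

Definition signal T : n.-tuple R := [tuple if i \in T then t else 0 | i < n].

Lemma add_coord_signal S j : j \notin S ->
  add_coord (signal S) t j = signal (j |: S).
Proof.
move=> jS; apply: eq_from_tnth => i; rewrite !tnth_mktuple !inE.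
by case: eqP => [->|_]; rewrite ?(negbTE jS) ?add0r ?addr0.
Qed.

Lemma signal_sparse T s : (#|T| <= s)%N -> sparse_ball s (signal T).
Proof.
apply: leq_trans; apply: subset_leq_card; apply/fintype.subsetP => i.
by rewrite inE/= tnth_mktuple; case: ifP => // _; rewrite eqxx.
Qed.

Definition selected bhat (j : 'I_n) : set (n.-tuple R) :=
  [set y | tnth (bhat y) j != 0].

Lemma measurable_selected bhat j :
  measurable_fun setT bhat -> measurable (selected bhat j).
Proof.
move=> mb.
have mbj : measurable_fun setT (fun y => tnth (bhat y) j).
  exact: (measurableT_comp (measurable_tnth j) mb).
rewrite (_ : selected _ _ = (fun y => tnth (bhat y) j) @^-1` (~` [set 0])).
  by rewrite -[X in measurable X]setTI; apply: mbj => //; exact: measurableC.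
by apply/seteqP; split => y /= /eqP.
Qed.

Lemma measurable_false_positive bhat (b : n.-tuple R) :
  measurable_fun setT bhat ->
  measurable [set y | (0 < false_positives (bhat y) b)%N].
Proof.
move=> mb.
rewrite (_ : [set _ | _] =
    \bigcup_(j in [set j | tnth b j == 0]) selected bhat j).
  apply: fin_bigcup_measurable => [|j _]; first exact: finite_finset.
  exact: measurable_selected.
apply/seteqP; split => y /=.
  by move=> /card_gt0P[j]; rewrite inE/= => /andP[? ?]; exists j.
by move=> [j /= bj yj]; apply/card_gt0P; exists j; rewrite inE/= bj andbT.
Qed.

Lemma selected_false_positive bhat S j : j \notin S ->
  selected bhat j `<=` [set y | (0 < false_positives (bhat y) (signal S))%N].
Proof.
move=> jS y yj; apply/card_gt0P; exists j.
by rewrite inE/= tnth_mktuple (negbTE jS) eqxx andbT.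
Qed.

(** Estimating 0 at a coordinate of [T], where the truth is [t], costs exactly t ^ 2; all other
    losses are bounded below by 0. *)
Lemma sq_risk_signal_ge bhat T : measurable_fun setT bhat ->
  ((t ^+ 2)%:E * \sum_(j in T) (1 - mvnormal (signal T) (selected bhat j)) <=
   sq_risk bhat (signal T))%E.
Proof.
move=> mb; rewrite /sq_risk [in leRHS]unlock.
have mbj j : measurable_fun setT (fun y => tnth (bhat y) j).
  exact: (measurableT_comp (measurable_tnth j) mb).
have -> : (\sum_(j in T) (1 - mvnormal (signal T) (selected bhat j)) =
    \int[mvnormal (signal T)]_y (\sum_(j in T) \1_(~` selected bhat j) y)%:E)%E.
  rewrite ge0_integral_sum_in.
  - apply: eq_bigr => j _; rewrite integral_indic//.
      by rewrite setIT; apply/esym/probability_setC; exact: measurable_selected.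
    by apply: measurableC; exact: measurable_selected.
  - move=> j; apply: measurable_indic; apply: measurableC.
    exact: measurable_selected.
  - by [].
have mind : measurable_fun setT
    (fun y => \sum_(j in T) (\1_(~` selected bhat j) y : R)).
  apply: measurable_sum_in => j; apply: measurable_indic; apply: measurableC.
  exact: measurable_selected.
rewrite -ge0_integralZl//; last 3 first.
- exact/measurable_EFinP.
- by move=> y _; rewrite lee_fin; apply: sumr_ge0.
- by rewrite lee_fin sqr_ge0.
apply: ge0_le_integral => //.
- by move=> y _; rewrite -EFinM lee_fin mulr_ge0 ?sqr_ge0//; apply: sumr_ge0.
- by apply: emeasurable_funM => //; exact/measurable_EFinP.
- apply/measurable_EFinP; apply: measurable_sum => j.
  by apply: measurable_funX; exact: measurable_funB.
- move=> y _; rewrite -EFinM lee_fin big_distrr/= /sqdist.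
  rewrite [leRHS](bigID (mem T))/= -[leLHS]addr0; apply: lerD; last first.
    by apply: sumr_ge0 => j _; exact: sqr_ge0.
  apply: ler_sum => j jT; rewrite tnth_mktuple jT indicE.
  have [|] := boolP (y \in _); rewrite ?mulr0 ?sqr_ge0// inE /selected/=.
  by move=> /negP; rewrite negbK => /eqP ->; rewrite sub0r sqrrN mulr1.
Qed.

(** Average the selection probability [a T j] over pairs with [j] in [T]. Seen from S = T minus j,
    the mixture bound keeps the average below M + d; seen from [T], the risk keeps the average of 1
    - a below the last term. The two averages add up to 1. *)
Lemma FP_risk_tradeoff bhat k (M rho eps : R) :
  measurable_fun setT bhat -> (k < n)%N -> 0 < t -> 0 < eps ->
  (forall T, (#|T| <= k.+1)%N -> (FP_prob bhat (signal T) <= M%:E)%E) ->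
  (forall T, (#|T| <= k.+1)%N -> (sq_risk bhat (signal T) <= rho%:E)%E) ->
  1 <= M + (eps + (expR (t ^+ 2) - 1) / (4 * eps * (n - k)%:R)) +
    rho / (k.+1%:R * t ^+ 2).
Proof.
move=> mb kn t0 eps0 hM hrho; set d := eps + _.
pose a T j := fine (mvnormal (signal T) (selected bhat j)).
have aE T j : mvnormal (signal T) (selected bhat j) = (a T j)%:E.
  by rewrite fineK// fin_num_measure//; exact: measurable_selected.
have nk0 : (0 < n - k)%N by rewrite subn_gt0.
have FPbound S : #|S| == k ->
    \sum_(j in ~: S) a (j |: S) j <= (n - k)%:R * (M + d).
  move=> /eqP Sk.
  have cS : #|~: S| = (n - k)%N by rewrite cardsCs finset.setCK card_ord Sk.
  have := @sum_mvnormal_add_coord_le R n (signal S) t (~: S) _ eps _ eps0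
    (measurable_false_positive (signal S) mb).
  rewrite cS => /(_ nk0) mix.
  rewrite -lee_fin -sumEFin.
  apply: (@le_trans _ _ (\sum_(j in ~: S) mvnormal (add_coord (signal S) t j)
    [set y | (0 < false_positives (bhat y) (signal S))%N])%E).
    (* The data are drawn with [j] in the support, but false positives are counted relative to [S],
       so selecting [j] implies the event. *)
    apply: lee_sum => j; rewrite inE => jS; rewrite add_coord_signal// -aE.
    apply: le_measure; rewrite ?inE.
    - exact: measurable_selected.
    - exact: measurable_false_positive.
    - exact: selected_false_positive.
  apply: le_trans mix _; rewrite EFinM lee_pmul2l ?lte_fin ?ltr0n//.
  by rewrite (EFinD M d); apply: leeD => //; apply: hM; rewrite Sk.
have riskbound T : #|T| == k.+1 -> \sum_(j in T) (1 - a T j) <= rho / t ^+ 2.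
  move=> /eqP Tk; rewrite ler_pdivlMr ?exprn_gt0// mulrC -lee_fin.
  apply: le_trans (hrho T _); last by rewrite Tk.
  apply: le_trans (sq_risk_signal_ge _ mb); rewrite EFinM -sumEFin.
  by under [in leRHS]eq_bigr do rewrite aE.
(* The number of pairs, counted with [k.+1] choices of [j] per [T] or [n - k] per [S]; it is
   positive because [k < n]. *)
pose K : R := \sum_(T : {set 'I_n} | #|T| == k.+1) k.+1%:R.
have KT : K = \sum_(T : {set 'I_n} | #|T| == k.+1) \sum_(j in T) 1.
  by apply: eq_bigr => T /eqP Tk; rewrite sumr_const Tk.
have KS : K = \sum_(S : {set 'I_n} | #|S| == k) (n - k)%:R.
  rewrite KT sum_subsetsS; apply: eq_bigr => S /eqP Sk.
  by rewrite sumr_const cardsCs finset.setCK card_ord Sk.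
have K0 : 0 < K.
  rewrite /K sumr_const pmulrn_rgt0 ?ltr0n//.
  by rewrite -cardsE card_draws card_ord bin_gt0.
rewrite -(ler_pM2l K0) mulr1.
have KE : K = \sum_(T : {set 'I_n} | #|T| == k.+1) \sum_(j in T) a T j +
    \sum_(T : {set 'I_n} | #|T| == k.+1) \sum_(j in T) (1 - a T j).
  rewrite -big_split/= KT; apply: eq_bigr => T _; rewrite -big_split/=.
  by apply: eq_bigr => j _; rewrite subrKC.
rewrite [leLHS]KE mulrDr; apply: lerD.
  rewrite sum_subsetsS KS big_distrl/=; exact: ler_sum.
rewrite /K big_distrl/=; apply: ler_sum => T Tk.
apply: le_trans (riskbound T Tk) _.
by rewrite (invfM k.+1%:R) [leRHS]mulrCA mulVKf ?pnatr_eq0.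
Qed.

End signal.

(** * Choice of parameters and conclusion *)

Lemma cvg_expR_ln_quarter (R : realType) :
  (2 * expR (- (ln n%:R / 4)) : R) @[n --> \oo] --> (0 : R).
Proof.
apply/cvgrPdist_lt => e e0; near=> n.
rewrite sub0r normrN ger0_norm ?mulr_ge0 ?expR_ge0//.
have n0 : 0 < n%:R :> R.
  by near: n; exact: nbhs_infty_gtr.
have : expR (- 4 * ln (e / 2)) < n%:R by near: n; exact: nbhs_infty_gtr.
rewrite -[ltRHS]lnK ?posrE// ltr_expR => lnn.
rewrite mulrC -ltr_pdivlMr// -[ltRHS]lnK ?posrE ?divr_gt0// ltr_expR.
lra.
Unshelve. all: by end_near. Qed.

Theorem theorem2p5 (R : realType) :
  exists2 C : R, 0 < C &
  forall (s : nat -> nat) (zeta : R),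
    (forall n, (0 < n)%N -> (1 <= s n <= n)%N) ->
    0 <= zeta < 1 ->
    limn_esup (fun n => ((s n)%:R / n%:R : R)%:E) = zeta%:E ->
  exists2 delta : nat -> R,
    (s n @[n --> \oo] --> \oo -> delta n @[n --> \oo] --> (0 : R)) &
    forall (n : nat) (bhat : n.-tuple R -> n.-tuple R),
      (0 < n)%N -> measurable_fun [set: n.-tuple R] bhat ->
      (ereal_sup [set FP_prob bhat b | b in sparse_ball (s n)] >=
       1 - (delta n)%:E -
       ereal_sup [set sq_risk bhat b | b in sparse_ball (s n)] /
         (C * (s n)%:R * ln n%:R)%:E)%E.
Proof.
(* One factor 1/2 comes from k.+1 >= s n / 2, the other from t ^ 2 = ln n / 2. *)
exists (4^-1); first by rewrite invr_gt0.
(* This is 2 n^(-1/4): one n^(-1/4) for the slack [eps], one for the variance term. *)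
move=> s zeta hs _ _; exists (fun n => 2 * expR (- (ln n%:R / 4))).
  by move=> _; exact: cvg_expR_ln_quarter.
move=> n bhat n0 mb; have /andP[s1 sn] := hs n n0.
(* [k.+1] is s n / 2 rounded up: large enough for the risk bound, and small enough that n - k >= n /
   2. *)
pose k := (s n).-1./2.
have ks : (k.+1 <= s n)%N by rewrite /k; lia.
have sk : (s n <= k.+1.*2)%N by rewrite /k; lia.
have kn : (k < n)%N by lia.
have nk : (n <= (n - k).*2)%N by rewrite /k; lia.
set M := ereal_sup [set FP_prob _ _ | _ in _].
set rho := ereal_sup [set sq_risk _ _ | _ in _].
have in_ball (T : {set 'I_n}) (t : R) :
    (#|T| <= k.+1)%N -> sparse_ball (s n) (signal t T).
  by move=> Tk; apply: signal_sparse; exact: leq_trans Tk ks.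
have M0 : (0 <= M)%E.
  apply: le_trans (ereal_sup_ubound _); last first.
    by exists (signal 0 finset.set0) => //; apply: in_ball; rewrite cards0.
  exact: measure_ge0.
have M1 : (M <= 1)%E.
  apply: ge_ereal_sup => _ [b _ <-]; apply: probability_le1.
  exact: measurable_false_positive.
have rho0 : (0 <= rho)%E.
  apply: le_trans (ereal_sup_ubound _); last first.
    by exists (signal 0 finset.set0) => //; apply: in_ball; rewrite cards0.
  by apply: expectation_ge0 => y; apply: sumr_ge0 => j _; exact: sqr_ge0.
have lnn0 : 0 <= ln n%:R :> R by rewrite ln_ge0// ler1n.
(* For n = 1 the logarithm vanishes: the quotient by 0 is still nonnegative and delta is 2, so the
   right side is negative. *)
have [n1|n1] := leqP n 1.
  have -> : n = 1%N by apply/eqP; rewrite eqn_leq n1.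
  apply: le_trans M0; rewrite ln1 mul0r oppr0 expR0 mulr1 mulr0.
  have h : (0 <= rho / 0%:E)%E by rewrite mule_ge0// inve_ge0.
  by apply: adde_le0; [rewrite -EFinB lee_fin; lra | rewrite oppe_le0].
have lnn : 0 < ln n%:R :> R by rewrite ln_gt0// ltr1n.
have c0 : 0 < 4^-1 * (s n)%:R * ln n%:R :> R by rewrite !mulr_gt0// ?ltr0n.
have hrho b : sparse_ball (s n) b -> (sq_risk bhat b <= rho)%E.
  by move=> bs; apply: ereal_sup_ubound; exists b.
clearbody rho; move: rho0 hrho.
rewrite inver gt_eqF//.
(* Infinite risk makes the right side -oo. *)
case: rho => [rho| |]//; last first.
  move=> _ _; rewrite gt0_mulye ?lte_fin ?invr_gt0//.
  by rewrite addeNy leNye.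
rewrite lee_fin => rho0 hrho.
rewrite -EFinM -!EFinB.
have Mfin : M \is a fin_num by rewrite ge0_fin_numE// (le_lt_trans M1)// ltry.
rewrite -(fineK Mfin) lee_fin.
(* Then exp (t ^ 2) = sqrt n = n eps ^ 2 for eps = n^(-1/4), and n - k >= n / 2 brings the variance
   term below [eps]. *)
pose t := Num.sqrt (ln n%:R / 2 : R).
have t2 : t ^+ 2 = ln n%:R / 2 by rewrite sqr_sqrtr// divr_ge0.
have t0 : 0 < t by rewrite sqrtr_gt0 divr_gt0.
pose eps : R := expR (- (ln n%:R / 4)).
have hM (T : {set 'I_n}) : (#|T| <= k.+1)%N ->
    (FP_prob bhat (signal t T) <= (fine M)%:E)%E.
  move=> Tk; rewrite fineK//; apply: ereal_sup_ubound.
  by exists (signal t T) => //; exact: in_ball.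
have hR (T : {set 'I_n}) : (#|T| <= k.+1)%N ->
    (sq_risk bhat (signal t T) <= rho%:E)%E.
  by move=> Tk; apply: hrho; exact: in_ball.
have := FP_risk_tradeoff mb kn t0 (expR_gt0 _ : 0 < eps) hM hR.
have N0 : 0 < (n - k)%:R :> R by rewrite ltr0n subn_gt0.
have detect : (expR (t ^+ 2) - 1) / (4 * eps * (n - k)%:R) <= eps.
  rewrite ler_pdivrMr ?mulr_gt0 ?expR_gt0// lerBlDr.
  have -> : expR (t ^+ 2) = n%:R * (eps * eps).
    rewrite -[n%:R in RHS]lnK ?posrE ?ltr0n// -!expRD t2; congr expR; lra.
  have eps2 : 0 <= eps * eps by rewrite mulr_ge0 ?expR_ge0.
  have nN : n%:R <= 2 * (n - k)%:R :> R.
    by rewrite -natrM ler_nat mul2n.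
  nra.
have risk : rho / (k.+1%:R * t ^+ 2) <= rho / (4^-1 * (s n)%:R * ln n%:R).
  rewrite ler_wpM2l// lef_pV2 ?posrE ?mulr_gt0 ?exprn_gt0 ?ltr0n// t2.
  have sN : (s n)%:R <= 2 * k.+1%:R :> R by rewrite -natrM ler_nat mul2n.
  nra.
move=> trade; rewrite -/eps -addrA -opprD lerBlDr.
apply: le_trans trade _; rewrite -addrA lerD2l; apply: lerD => //.
by rewrite (_ : 2 * eps = eps + eps) ?lerD2l//; ring.
Qed.
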